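(* Let $1\le k\le n$ be integers and let $\zeta\ge0$ be a real parameter. Let $|\psi\rangle\in\mathcal H^{\otimes n}$ be a $k$-separable pure state, that is, after permuting the $n$ systems it can be written as $|\psi\rangle=|\phi_1\rangle\otimes\cdots\otimes|\phi_l\rangle$ with pure states $|\phi_i\rangle\in\mathcal H^{\otimes r_i}$, $r_i\le k$, and suppose that every state $|\phi_i\rangle$ appearing in this decomposition satisfies the non-zero thickness condition $\Delta_{|\phi_i\rangle}(\hat P^{(r_i)}_j)\ge\zeta\,\Delta_{|\phi_i\rangle}(\hat P^{(r_i)}_1)$ for all $j\in\{2,\dots,r_i\}$. Then $$F_{|\psi\rangle}\le\left\lfloor\frac nk\right\rfloor\frac{k^2}{(1-\zeta)+k\zeta}+\frac{\left(n-\lfloor n/k\rfloor k\right)^2}{(1-\zeta)+\left(n-\lfloor n/k\rfloor k\right)\zeta}\le\frac{kn}{(1-\zeta)+k\zeta},$$ where the second term of the middle expression is understood to be $0$ when $k$ divides $n$.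
   Context: $\mathcal H$ is a complex Hilbert space (finite or infinite-dimensional), and $\hat H$ is a self-adjoint operator (Hamiltonian) on $\mathcal H$ with non-degenerate eigenvalues. For each $r\ge1$, on $\mathcal H^{\otimes r}$, $\hat H_i=\mathbf 1^{\otimes(i-1)}\otimes\hat H\otimes\mathbf 1^{\otimes(r-i)}$ and $\hat H_{\mathrm{coll}}=\sum_{i=1}^r\hat H_i$. For each $r$, fix a real orthogonal $r\times r$ matrix $(\alpha^{(r)}_{ij})$ with $\alpha^{(r)}_{1j}=1/\sqrt r$ for all $j$, and set $\hat P^{(r)}_i=\sum_{j=1}^r\alpha^{(r)}_{ij}\hat H_j$ (so $\hat P^{(r)}_1=\hat H_{\mathrm{coll}}/\sqrt r$). Pure states are unit vectors (for which the variances below are assumed to exist); $\Delta_{|\psi\rangle}(\hat A)=\langle\psi|\hat A^2|\psi\rangle-\langle\psi|\hat A|\psi\rangle^2$ denotes the variance. For a pure state $|\psi\rangle\in\mathcal H^{\otimes n}$, $F_{|\psi\rangle}=\Delta_{|\psi\rangle}(\hat H_{\mathrm{coll}})/\max_{1\le i\le n}\Delta_{|\psi\rangle}(\hat H_i)$ if the denominator is nonzero, and $F_{|\psi\rangle}=0$ otherwise.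
   Formalization: The parameter ζ is additionally required to satisfy ζ ≤ 1 when k ≥ 2; for ζ > 1 and n ≥ k ≥ 2 the claim fails, e.g. for n = k = 2, ζ = 2 and the product state |+⟩|+⟩ one has F = 2 > 4/3. *)

(* Defs.v *)
From HB Require Import structures.
From mathcomp Require Import all_boot all_order all_algebra.
From mathcomp Require Import complex.
From mathcomp Require Import all_classical reals topology normedtype.

Set Implicit Arguments.
Unset Strict Implicit.
Unset Printing Implicit Defensive.

Import Order.TTheory GRing.Theory Num.Theory.
Import numFieldNormedType.Exports.

Local Open Scope classical_set_scope.
Local Open Scope ring_scope.
Local Open Scope complex_scope.

Structure hilbert (R : realType) := Hilbert {
  hilbert_sort :> completeNormedModType R[i];
  hilbert_dot : {dot hilbert_sort for Num.conj};
  hilbert_normE : forall x, `|x| ^+ 2 = hilbert_dot x x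
}.

(* [dot] is linear in its first argument, the Dirac bracket <u|v> in its
   second one. *)
Definition braket (R : realType) (H : hilbert R) (u v : H) : R[i] :=
  hilbert_dot H v u.

(* Possibly unbounded operators: the values of [op_fun] outside [op_dom] are
   meaningless. *)
Record operator (R : realType) (H : hilbert R) := Operator {
  op_dom : set H;
  op_fun :> H -> H
}.

Definition op_linear (R : realType) (H : hilbert R) (A : operator H) : Prop :=
  op_dom A 0 /\
  forall (a : R[i]) (u v : H), op_dom A u -> op_dom A v ->
    op_dom A (a *: u + v) /\ A (a *: u + v) = a *: A u + A v.

(* For densely defined [A], [adjoint_graph A y z] says that y is in the domain
   of the adjoint A* and that A* y = z. *)
Definition adjoint_graph (R : realType) (H : hilbert R) (A : operator H)
    (y z : H) : Prop :=
  forall x, op_dom A x -> braket y (A x) = braket z x.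

Definition self_adjoint (R : realType) (H : hilbert R) (A : operator H) : Prop :=
  [/\ op_linear A, dense (op_dom A) &
      forall y z, adjoint_graph A y z <-> op_dom A y /\ A y = z].

Definition nondegenerate_eigenvalues (R : realType) (H : hilbert R)
    (A : operator H) : Prop :=
  forall (E : R[i]) (u v : H), op_dom A u -> op_dom A v ->
    A u = E *: u -> A v = E *: v -> u != 0 -> exists c : R[i], v = c *: u.

Definition op_lincomb (R : realType) (H : hilbert R) (r : nat)
    (c : 'I_r -> R) (A : 'I_r -> operator H) : operator H :=
  Operator (\bigcap_j op_dom (A j))
           (fun psi => \sum_(j < r) (c j)%:C *: A j psi).

(* The expectation value is real for symmetric [A], so taking the real part
   loses nothing. *)
Definition op_expectation (R : realType) (H : hilbert R) (A : operator H)
    (psi : H) : R :=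
  complex.Re (braket psi (A psi)).

(* For symmetric [A], <A psi|A psi> is the value on [op_dom A] of the quadratic
   form <psi|A^2|psi>; it does not require [A psi] to be in the domain. *)
Definition op_variance (R : realType) (H : hilbert R) (A : operator H)
    (psi : H) : R :=
  complex.Re (braket (A psi) (A psi)) - op_expectation A psi ^+ 2.

(* Hilbert tensor power of H, given up to unitary isomorphism by its product
   vectors: [tensor x] is x_1 (x) ... (x) x_r. *)
Structure tensor_power (R : realType) (H : hilbert R) (r : nat) := TensorPower {
  tensor_space :> hilbert R;
  tensor : ('I_r -> H) -> tensor_space;
  tensor_linear : forall (x : 'I_r -> H) (i : 'I_r) (a : R[i]) (u v : H),
    tensor (dfwith x i (a *: u + v)) =
    a *: tensor (dfwith x i u) + tensor (dfwith x i v);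
  tensor_braket : forall x y : 'I_r -> H,
    braket (tensor x) (tensor y) = \prod_(i < r) braket (x i) (y i);
  tensor_dense : dense [set psi : tensor_space |
    exists (N : nat) (c : 'I_N -> R[i]) (x : 'I_N -> 'I_r -> H),
      psi = \sum_(a < N) c a *: tensor (x a)]
}.

(* Graph of 1 (x) ... (x) A (x) ... (x) 1, with A in position i, on the
   algebraic span of the product vectors x with x_i in the domain of A. *)
Definition site_graph (R : realType) (H : hilbert R) (r : nat)
    (T : tensor_power H r) (A : operator H) (i : 'I_r) : set (T * T) :=
  [set p | exists (N : nat) (c : 'I_N -> R[i]) (x : 'I_N -> 'I_r -> H),
    [/\ forall a, op_dom A (x a i),
        p.1 = \sum_(a < N) c a *: tensor T (x a) &
        p.2 = \sum_(a < N) c a *: tensor T (dfwith (x a) i (A (x a i)))]].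

(* The operator acting as A on system i: the closure of the previous one, which
   is closable when A is self-adjoint, so that [xget] has a single choice. *)
Definition site_op (R : realType) (H : hilbert R) (r : nat)
    (T : tensor_power H r) (A : operator H) (i : 'I_r) : operator T :=
  Operator [set psi : T | exists chi, closure (site_graph (T := T) A i) (psi, chi)]
           (fun psi => xget 0 [set chi | closure (site_graph (T := T) A i) (psi, chi)]).

Definition collective_op (R : realType) (H : hilbert R) (r : nat)
    (T : tensor_power H r) (A : operator H) : operator T :=
  op_lincomb (fun=> 1) (site_op T A).

Definition mode_op (R : realType) (H : hilbert R) (r : nat)
    (T : tensor_power H r) (A : operator H) (alpha : 'M[R]_r) (i : 'I_r) :
    operator T :=
  op_lincomb (alpha i) (site_op T A).

(* Unit vectors in the domain of every H_i, so that all variances of the H_i,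
   of their sum and of the modes exist. *)
Definition pure_state (R : realType) (H : hilbert R) (r : nat)
    (T : tensor_power H r) (A : operator H) (psi : T) : Prop :=
  `|psi| = 1 /\ forall i : 'I_r, op_dom (site_op T A i) psi.

(* Variances being nonnegative, the neutral element 0 does not affect the
   maximum when n > 0. *)
Definition coherence_ratio (R : realType) (H : hilbert R) (n : nat)
    (T : tensor_power H n) (A : operator H) (psi : T) : R :=
  let d := \big[Num.max/0]_(i < n) op_variance (site_op T A i) psi in
  if d == 0 then 0 else op_variance (collective_op T A) psi / d.

(* [psi] is phi_1 (x) ... (x) phi_l after a permutation of the systems, e m j
   being the place among the n systems of the j-th system of phi_m. The
   product is determined by its brackets with the product vectors, which span
   a dense subspace. *)
Definition is_product_state (R : realType) (H : hilbert R)
    (T : forall r, tensor_power H r) (n l : nat) (r : 'I_l -> nat)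
    (e : {m : 'I_l & 'I_(r m)} -> 'I_n) (phi : forall m : 'I_l, T (r m))
    (psi : T n) : Prop :=
  bijective e /\
  forall x : 'I_n -> H,
    braket (tensor (T n) x) psi =
    \prod_(m < l) braket (tensor (T (r m))
                            (fun j => x (e (Tagged (fun m => 'I_(r m)) j))))
                         (phi m).

(* Main.v *)
(** Since [psi] is a product over the blocks, sites in different blocks are
uncorrelated, so the collective variance of [psi] is the sum of those of the
[phi m]. Orthogonality of [alpha] makes the mode variances of a block of size
[r] sum to its site variances, at most [r * d] with [d] the maximal site
variance; thickness then bounds the variance of the first mode, so the collective
variance of the block is at most [f r * d] with
[f r = r ^ 2 / (1 - zeta + r * zeta)]. As [f] is convex with [f 0 = 0], the sum
of [f] over block sizes at most [k] is largest when as many blocks as possible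
have size [k].

The analytic input is that the bracket of two product states is the product of
the brackets of their factors, and that the (closed) site operators act
factorwise on product states. *)

Require Import Defs.
From mathcomp Require Import all_boot all_order all_algebra.
From mathcomp Require Import all_classical reals topology normedtype.
From mathcomp Require Import complex.
From mathcomp Require Import zify lra ring.

Import Order.TTheory GRing.Theory Num.Theory.
Import numFieldNormedType.Exports.
Local Open Scope ring_scope.

Local Open Scope complex_scope.
Set Implicit Arguments.
Unset Strict Implicit.
Unset Printing Implicit Defensive.

(** * Brackets and the Cauchy-Schwarz inequality *)

Section Bracket.
Context {R : realType} {H : hilbert R}.
Implicit Types (u v w : H) (a : R[i]).

Lemma braketC u v : braket u v = Num.conj (braket v u).
Proof. by rewrite /braket hermC expr0 mul1r. Qed.

Lemma braketBr u v w : braket u (v - w) = braket u v - braket u w.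
Proof. exact: linearBl. Qed.

Lemma braketZr a u v : braket u (a *: v) = a * braket u v.
Proof. exact: linearZl_LR. Qed.

Lemma braket_sumr (I : Type) (s : seq I) (P : pred I) u (F : I -> H) :
  braket u (\sum_(i <- s | P i) F i) = \sum_(i <- s | P i) braket u (F i).
Proof. exact: linear_sumlz. Qed.

Lemma braketBl u v w : braket (u - v) w = braket u w - braket v w.
Proof. by rewrite braketC braketBr rmorphB (braketC u) (braketC v). Qed.

Lemma braketZl a u v : braket (a *: u) v = Num.conj a * braket u v.
Proof. by rewrite braketC braketZr rmorphM (braketC u). Qed.

Lemma braket_suml (I : Type) (s : seq I) (P : pred I) u (F : I -> H) :
  braket (\sum_(i <- s | P i) F i) u = \sum_(i <- s | P i) braket (F i) u.
Proof.
rewrite braketC braket_sumr rmorph_sum.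
by apply: eq_bigr => i _; rewrite (braketC (F i)).
Qed.

Lemma braket_norm u : braket u u = `|u| ^+ 2.
Proof. by rewrite hilbert_normE. Qed.

Lemma braket_cauchy_schwarz u v : `|braket u v| <= `|u| * `|v|.
Proof.
have [->|v0] := eqVneq v 0.
  by rewrite /braket linear0l normr0 normr0 mulr0.
have nv : 0 < `|v| ^+ 2 by rewrite exprn_gt0// normr_gt0.
(* [w] is the component of [u] orthogonal to [v], multiplied by the squared norm of [v] to avoid a
   division. *)
pose w := (`|v| ^+ 2) *: u - braket v u *: v.
have wv : braket w v = 0.
  rewrite braketC braketBr !braketZr braket_norm mulrC subrr; exact: rmorph0.
have : 0 <= braket w w by rewrite braket_norm exprn_ge0.
rewrite {2}/w braketBr !braketZr wv mulr0 subr0 pmulr_rge0//.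
rewrite braketBl !braketZl braket_norm geC0_conj ?exprn_ge0// mulrC.
rewrite [X in _ - X]mulrC -normCK braketC norm_conjC subr_ge0.
rewrite -exprMn => h; rewrite -(@ler_pXn2r _ 2)// ?nnegrE ?mulr_ge0//.
Qed.

End Bracket.

(** * Continuity of brackets and extension of identities by density *)

Lemma lipschitz_continuous_at (K : numFieldType) (V W : normedModType K)
    (f : V -> W) (C : K) :
  0 <= C -> (forall x y, `|f x - f y| <= C * `|x - y|) -> continuous f.
Proof.
move=> C0 hf x; apply/cvgrPdist_le => e e0.
have C1 : 0 < C + 1 by rewrite ltr_wpDl.
have e1 : 0 < e / (C + 1) by rewrite divr_gt0.
have near_x : \forall y \near x, `|x - y| <= e / (C + 1).
  by apply: (cvgr_dist_le idfun x) => //; exact: cvg_id.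
near=> y; apply: (le_trans (hf _ _)).
by rewrite -[leRHS](divfK (lt0r_neq0 C1)) mulrC ler_pM ?lerDl.
Unshelve. all: by end_near. Qed.

Section BracketContinuity.
Context {R : realType} {H : hilbert R}.

Lemma braket_continuous_r (u : H) :
  continuous (braket u : H -> (R[i])^o).
Proof.
apply: (lipschitz_continuous_at (C := `|u|)) => // x y.
by rewrite -braketBr; exact: braket_cauchy_schwarz.
Qed.

Lemma braket_continuous_l (u : H) :
  continuous ((fun v => braket v u) : H -> (R[i])^o).
Proof.
apply: (lipschitz_continuous_at (C := `|u|)) => // x y.
by rewrite -braketBl mulrC; exact: braket_cauchy_schwarz.
Qed.

End BracketContinuity.

Lemma closed_eq_fun (X : topologicalType) (Y : topologicalType) (f g : X -> Y) :
  hausdorff_space Y -> continuous f -> continuous g ->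
  closed [set x | f x = g x]%classic.
Proof.
move=> hY cf cg x clx; apply: hY => A B nA nB.
have nfA : nbhs x (f @^-1` A)%classic := cf x A nA.
have ngB : nbhs x (g @^-1` B)%classic := cg x B nB.
have := clx _ (filterI nfA ngB).
by case=> y [/= fg [Ay By]]; exists (f y); split => //; rewrite fg.
Qed.

Lemma dense_eq_fun (X : topologicalType) (Y : topologicalType) (S : set X)
    (f g : X -> Y) :
  hausdorff_space Y -> continuous f -> continuous g -> dense S ->
  (forall x, S x -> f x = g x) -> f =1 g.
Proof.
move=> hY cf cg dS fg x.
have : closure S x.
  move=> B; rewrite nbhsE => -[O [oO Ox] OB].
  have [y [Oy Sy]] := dS O (ex_intro _ x Ox) oO.
  by exists y; split => //; exact: OB.
by move/(closure_subset (fg : S `<=` [set x | f x = g x])%classic); exact: closed_eq_fun.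
Qed.

(** * Product vectors and the closed site operators *)

Section SiteOperators.
Context {R : realType} {H : hilbert R} {r : nat} (T : tensor_power H r).
Implicit Types (x y : 'I_r -> H) (i : 'I_r) (psi chi : T).

Lemma norm_tensor x : `|tensor T x| = \prod_i `|x i|.
Proof.
have : `|tensor T x| ^+ 2 == (\prod_i `|x i|) ^+ 2.
  rewrite -braket_norm tensor_braket -prodrXl.
  by apply/eqP/eq_bigr => i _; rewrite braket_norm.
by rewrite eqrXn2 ?prodr_ge0// => /eqP.
Qed.

Lemma tensor_dfwithB x i u v :
  tensor T (dfwith x i u) - tensor T (dfwith x i v) =
  tensor T (dfwith x i (u - v)).
Proof.
by rewrite addrC -scaleN1r -tensor_linear scaleN1r addrC.
Qed.

Lemma tensor_dfwith_continuous x i :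
  continuous (fun v => tensor T (dfwith x i v)).
Proof.
apply: (lipschitz_continuous_at (C := \prod_(j | j != i) `|x j|)).
  exact: prodr_ge0.
move=> u v; rewrite tensor_dfwithB norm_tensor (bigD1 i)//= dfwithin mulrC.
rewrite ler_wpM2r// (_ : \prod_(_ | _) _ = \prod_(j | j != i) `|x j|)//.
by apply: eq_bigr => j ji; rewrite dfwithout// eq_sym.
Qed.

Section Symmetric.
Context (A : operator H).
Hypothesis A_sa : self_adjoint A.

Lemma self_adjoint_braket u v :
  op_dom A u -> op_dom A v -> braket u (A v) = braket (A u) v.
Proof.
case: A_sa => _ _ adj du dv.
by have [_ h] := adj u (A u); exact: (h (conj du erefl)).
Qed.

Lemma closed_braket_eq (u v : T) :
  closed [set p : T * T | braket u p.2 = braket v p.1]%classic.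
Proof.
apply: (@closed_eq_fun _ (R[i])^o) => [|p|p]; first exact: norm_hausdorff.
- by apply: continuous_comp; [exact: cvg_snd|exact: braket_continuous_r].
- by apply: continuous_comp; [exact: cvg_fst|exact: braket_continuous_r].
Qed.

(** On the algebraic graph the identity follows from the symmetry of [A]. It is a closed condition
    on the pair, so it survives the closure. *)
Lemma site_closure_tensor psi chi i y :
  op_dom A (y i) -> closure (site_graph (T := T) A i) (psi, chi) ->
  braket (tensor T y) chi = braket (tensor T (dfwith y i (A (y i)))) psi.
Proof.
move=> dy cl.
apply: (@closed_braket_eq (tensor T y) (tensor T (dfwith y i (A (y i)))) (psi, chi)).
apply: closure_subset cl => p [N [c [x [dx p1 p2]]]] /=; rewrite p1 p2.
rewrite !braket_sumr; apply: eq_bigr => a _; rewrite !braketZr !tensor_braket.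
rewrite (bigD1 i)//= [in RHS](bigD1 i)//= !dfwithin self_adjoint_braket//.
by congr (_ * (_ * _)); apply: eq_bigr => j ji; rewrite !dfwithout// eq_sym.
Qed.

(** The closedness argument is repeated in the second pair: with [(psi, chi)] fixed,
    [site_closure_tensor] gives the identity on the algebraic graph. *)
Lemma site_closure_symmetric psi chi psi' chi' i :
  closure (site_graph (T := T) A i) (psi, chi) ->
  closure (site_graph (T := T) A i) (psi', chi') ->
  braket psi' chi = braket chi' psi.
Proof.
move=> cl cl'; rewrite (braketC psi') (braketC chi'); congr Num.conj.
symmetry; apply: (@closed_braket_eq psi chi (psi', chi')).
apply: closure_subset cl' => p [N [c [x [dx p1 p2]]]] /=; rewrite p1 p2.
rewrite !braket_sumr; apply: eq_bigr => a _; rewrite !braketZr.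
rewrite (braketC psi) (braketC chi).
by rewrite (site_closure_tensor (dx a) cl).
Qed.

Lemma site_op_closure psi i :
  op_dom (site_op T A i) psi ->
  closure (site_graph (T := T) A i) (psi, site_op T A i psi).
Proof. by move=> dpsi; have := @xgetPex _ 0 _ dpsi. Qed.

Lemma site_expectation_real psi i :
  op_dom (site_op T A i) psi ->
  complex.Im (braket psi (site_op T A i psi)) = 0.
Proof.
move=> /site_op_closure cl.
have := site_closure_symmetric cl cl.
rewrite [RHS]braketC; case: (braket _ _) => a b /= [].
move=> /eqP; rewrite eq_sym -subr_eq0 => /eqP. lra.
Qed.

End Symmetric.
End SiteOperators.

(** * Finite sums of product vectors *)

Section TensorSpan.
Context {R : realType} {H : hilbert R} {r : nat} (T : tensor_power H r).

Definition tensor_span : set T :=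
  [set psi : T | exists (N : nat) (c : 'I_N -> R[i]) (x : 'I_N -> 'I_r -> H),
      psi = \sum_(a < N) c a *: tensor T (x a)]%classic.

(** Padding with zero coefficients lets the expansions of different blocks share one number of
    terms. *)
Lemma tensor_span_pad (psi : T) : tensor_span psi ->
  exists N (c : nat -> R[i]) (x : nat -> 'I_r -> H),
    forall M, (N <= M)%N -> psi = \sum_(a < M) c a *: tensor T (x a).
Proof.
move=> [N [c [x ->]]]; exists N.
exists (fun t => if insub t is Some a then c a else 0).
exists (fun t => if insub t is Some a then x a else fun=> 0) => M NM.
pose F t := if insub t is Some a then c a *: tensor T (x a) else 0.
transitivity (\sum_(a < N) F a).
  by apply: eq_bigr => a _; rewrite /F valK.
rewrite (big_ord_widen_cond _ xpredT F NM) big_mkcond /=.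
apply: eq_bigr => a _; rewrite /F; case: insubP => [b -> _|/negbTE ->] //.
by rewrite scale0r.
Qed.

Lemma tensor_span_approx (psi : T) (eps : R[i]) :
  0 < eps -> exists2 a, tensor_span a & `|psi - a| < eps.
Proof.
move=> e0; have [||a [ae sa]] := @tensor_dense _ _ _ T (ball psi eps).
- by exists psi; exact: ballxx.
- exact: ball_open.
- by exists a => //; move: ae; rewrite -ball_normE.
Qed.

End TensorSpan.

(** * Brackets of product states and site operators acting on them *)

Section ProductStates.
Context {R : realType} {H : hilbert R} (T : forall r, tensor_power H r).
Context {n l : nat} {r : 'I_l -> nat} (e : {m : 'I_l & 'I_(r m)} -> 'I_n).

Local Notation site m j := (e (Tagged (fun m => 'I_(r m)) (i:=m) j)).
Local Notation block x m := (fun j => x (site m j)).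

Lemma big_sites (S : Type) (idx : S) (op : Monoid.com_law idx) (F : 'I_n -> S) :
  bijective e ->
  \big[op/idx]_i F i = \big[op/idx]_(m < l) \big[op/idx]_(j < r m) F (site m j).
Proof.
move=> be; rewrite (reindex e) /=; last exact: onW_bij.
by rewrite sig_big_dep /=; apply: eq_bigr => -[].
Qed.

Lemma tensor_is_product_state x :
  bijective e ->
  is_product_state e (fun m => tensor (T (r m)) (block x m)) (tensor (T n) x).
Proof.
move=> be; split=> // y; rewrite tensor_braket big_sites//.
by apply: eq_bigr => m _; rewrite tensor_braket.
Qed.

(** For factors that are finite sums, the product vector can be written down by multiplying out.
    This supplies approximants for general factors. *)
Lemma span_product_state (a : forall m, T (r m)) :
  bijective e -> (forall m, tensor_span (a m)) ->
  exists2 w : T n, is_product_state e a w &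
    forall (phi : forall m, T (r m)) psi, is_product_state e phi psi ->
      braket psi w = \prod_m braket (phi m) (a m).
Proof.
move=> be sa; case: (be) => g eK gK.
have pad m : exists z : nat * (nat -> R[i]) * (nat -> 'I_(r m) -> H),
    forall M, (z.1.1 <= M)%N ->
      a m = \sum_(t < M) z.1.2 t *: tensor (T (r m)) (z.2 t).
  by have [N [c [x h]]] := tensor_span_pad (sa m); exists (N, c, x).
pose z m := sval (cid (pad m)).
pose M := (\max_(m < l) (z m).1.1)%N.
have aE m : a m = \sum_(t < M) (z m).1.2 t *: tensor (T (r m)) ((z m).2 t).
  exact: (svalP (cid (pad m)) M (leq_bigmax (F := fun m => (z m).1.1) m)).
(* A function [f] picks one term in each block; [y f] assembles their factors into a family over all
   [n] sites. *)
pose y (f : {ffun 'I_l -> 'I_M}) i := (z (tag (g i))).2 (f (tag (g i))) (tagged (g i)).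
have yE f m : block (y f) m = (z m).2 (f m).
  by apply: funext => j; rewrite /y eK.
pose w := \sum_(f : {ffun 'I_l -> 'I_M}) (\prod_m (z m).1.2 (f m)) *: tensor (T n) (y f).
have wE (phi : forall m, T (r m)) psi : is_product_state e phi psi ->
    braket psi w = \prod_m braket (phi m) (a m).
  move=> [_ hp]; transitivity (\prod_m \sum_(t < M)
      (z m).1.2 t * braket (phi m) (tensor (T (r m)) ((z m).2 t))).
    rewrite bigA_distr_bigA /w braket_sumr; apply: eq_bigr => f _.
    rewrite braketZr big_split /= braketC hp rmorph_prod; congr (_ * _).
    by apply: eq_bigr => m _; rewrite yE; symmetry; exact: braketC.
  apply: eq_bigr => m _; rewrite aE braket_sumr.
  by apply: eq_bigr => t _; rewrite braketZr.
exists w => //; split=> // x.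
exact: (wE _ _ (tensor_is_product_state x be)).
Qed.

(* The approximants [w eps] are bounded and converge weakly to [psi], since
   their brackets with the (total) product vectors converge. *)
Lemma braket_product_states (phi phi' : forall m, T (r m)) (psi psi' : T n) :
  is_product_state e phi psi -> is_product_state e phi' psi' ->
  braket psi' psi = \prod_m braket (phi' m) (phi m).
Proof.
move=> pp pp'; have be := pp.1.
(* The statement is made total in [eps], with a dummy witness when [eps] is not positive, so that
   [choice] applies. *)
have approx (eps : R[i]) : exists aw : (forall m, T (r m)) * T n, 0 < eps ->
    [/\ forall m, `|phi m - aw.1 m| < eps, `|aw.2| = \prod_m `|aw.1 m| &
     forall (phi : forall m, T (r m)) psi, is_product_state e phi psi ->
      braket psi aw.2 = \prod_m braket (phi m) (aw.1 m)].
  have [e0|] := boolP (0 < eps); last by exists (phi, 0).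
  have ap m := tensor_span_approx (phi m) e0.
  pose a m := s2val (cid2 (ap m)).
  have sa m : tensor_span (a m) by rewrite /a; case: (cid2 _).
  have [w paw aw] := span_product_state be sa.
  exists (a, w) => _; split=> //= [m|]; first by rewrite /a; case: (cid2 _).
  have : `|w| ^+ 2 == (\prod_m `|a m|) ^+ 2.
    rewrite -braket_norm (aw _ _ paw) -prodrXl.
    by apply/eqP/eq_bigr => m _; rewrite braket_norm.
  by rewrite eqrXn2 ?prodr_ge0// => /eqP.
have [aw awP] := choice approx.
pose F : set_system R[i] := (0^'+)%classic.
have FF : ProperFilter F := at_right_proper_filter _.
have F0 : \forall eps \near F, 0 < eps by exact: nbhs_right_gt.
have acvg m : ((aw eps).1 m @[eps --> F] --> phi m)%classic.
  apply/cvgrPdist_lt => d d0; near=> eps.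
  have e0 : 0 < eps by near: eps; exact: nbhs_right_gt.
  have [h _ _] := awP eps e0; apply: (lt_trans (h m)).
  by near: eps; exact: nbhs_right_lt.
have wcvg (chi : forall m, T (r m)) v : is_product_state e chi v ->
    (braket v (aw eps).2 @[eps --> F] --> (\prod_m braket (chi m) (phi m) : (R[i])^o))%classic.
  move=> pv.
  apply: (@cvg_trans _ ((\prod_m braket (chi m) ((aw eps).1 m) : (R[i])^o) @[eps --> F])%classic).
    apply: near_eq_cvg; near=> eps.
    have e0 : 0 < eps by near: eps.
    by have [_ _ h] := awP eps e0; rewrite (h _ _ pv).
  apply: cvg_big => [|m _]; first exact: mul_continuous.
  have h := cvg_comp (fun eps => (aw eps).1 m) (braket (chi m)) (acvg m).
  have k := @braket_continuous_r R (T (r m)) (chi m) (phi m).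
  exact: h k.
(* By [wcvg] these brackets tend to the product of the block brackets, so by uniqueness of limits it
   is enough that they also tend to the bracket with [psi]. *)
suff wpsi : (braket psi' (aw eps).2 @[eps --> F] --> (braket psi' psi : (R[i])^o))%classic.
  exact: (cvg_unique (norm_hausdorff (V := (R[i])^o)) wpsi (wcvg _ _ pp')).
have spancvg v : tensor_span v ->
    (braket v (aw eps).2 @[eps --> F] --> (braket v psi : (R[i])^o))%classic.
  move=> [N [c [x ->]]]; rewrite braket_suml.
  under eq_fun do rewrite braket_suml.
  apply: (@cvg_big (R[i])^o) => [|t _]; first exact: add_continuous.
  rewrite braketZl; under eq_fun do rewrite braketZl.
  apply: cvgM; first exact: cvg_cst.
  rewrite pp.2; exact: (wcvg _ _ (tensor_is_product_state (x t) be)).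
(* [C] bounds the norms of the approximants once [eps < 1]. *)
pose C := \prod_m (`|phi m| + 1).
have C0 : 0 <= C by apply: prodr_ge0 => m _; rewrite addr_ge0.
have wC : \forall eps \near F, `|(aw eps).2| <= C.
  near=> eps.
  have e0 : 0 < eps by near: eps.
  have [h -> _] := awP eps e0.
  apply: ler_prod => m _; rewrite normr_ge0/=.
  rewrite -[X in `|X|](subKr (phi m)) (le_trans (ler_normB _ _))// lerD2l.
  apply/ltW/(lt_trans (h m)).
  by near: eps; exact: nbhs_right_lt.
apply/(@cvgrPdist_le _ (R[i])^o) => d d0.
(* [K] bounds the norm of [psi - (aw eps).2]; the added 1 makes it positive, so that [psi'] can be
   approximated within [d / 2 / K]. *)
pose K := `|psi| + C + 1.
have K0 : 0 < K by rewrite ltr_wpDl// addr_ge0.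
have [|v sv vd] := @tensor_span_approx _ _ _ (T n) psi' (d / 2 / K).
  by rewrite !divr_gt0.
have /(@cvgrPdist_le _ (R[i])^o)/(_ (d / 2)) := spancvg v sv.
move=> /(_ (divr_gt0 d0 (ltr0Sn _ _))) near_v.
near=> eps.
rewrite (_ : _ - _ = (braket v psi - braket v (aw eps).2)
                   + braket (psi' - v) (psi - (aw eps).2)); last first.
  by rewrite braketBl !braketBr; ring.
rewrite [leRHS](splitr d) (le_trans (ler_normD _ _))// lerD//.
  by near: eps.
apply: (le_trans (braket_cauchy_schwarz _ _)).
rewrite -[leRHS](divfK (lt0r_neq0 K0)) ler_pM//; first exact: ltW.
rewrite (le_trans (ler_normB _ _))// /K -addrA lerD2l.
rewrite (@le_trans _ _ C)// ?lerDl//.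
by near: eps.
Unshelve. all: by end_near. Qed.

(** When the test vector has its factor at the chosen site in the domain of [A], the operator can be
    moved onto that factor on both sides, and the product form of [psi] applies. Both sides are
    continuous in that factor and the domain is dense, so the identity holds for every test
    vector. *)
Lemma site_product_state (A : operator H) (phi : forall m, T (r m)) (psi : T n)
    m (j : 'I_(r m)) (w : T (r m)) (chi : T n) :
  self_adjoint A -> is_product_state e phi psi ->
  closure (site_graph (T := T (r m)) A j) (phi m, w) ->
  closure (site_graph (T := T n) A (site m j)) (psi, chi) ->
  is_product_state e (dfwith phi m w) chi.
Proof.
move=> saA [be pp] clw clchi; split=> // x; set i := site m j.
have ei : injective e := bij_inj be.
have blockm v : block (dfwith x i v) m = dfwith (block x m) j v.
  apply: funext => j' /=; have [<-|jj'] := eqVneq j j'; first by rewrite !dfwithin.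
  by rewrite !dfwithout// (inj_eq ei) eq_Tagged.
have blockm' v m' : m' != m -> block (dfwith x i v) m' = block x m'.
  move=> mm'; apply: funext => j' /=; rewrite dfwithout// (inj_eq ei).
  by apply: contra mm' => /eqP h; rewrite -[m']/(tag (Tagged (fun m => 'I_(r m)) j')) -h.
(* The contribution of the blocks other than [m], which does not change when the factor at site [i]
   varies. *)
pose rest := \prod_(m' | m' != m) braket (tensor (T (r m')) (block x m')) (phi m').
have eq_dense : (fun v => braket (tensor (T n) (dfwith x i v)) chi : (R[i])^o)
   =1 (fun v => braket (tensor (T (r m)) (dfwith (block x m) j v)) w * rest).
  have [_ dA _] := saA.
  apply: (dense_eq_fun _ _ _ dA) => [|v|v|v dv].
  - exact: norm_hausdorff.
  - apply: (continuous_comp (f := fun v => tensor (T n) (dfwith x i v))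
      (g := fun u => braket u chi : (R[i])^o)).
      exact: tensor_dfwith_continuous.
    exact: braket_continuous_l.
  - apply: cvgM; last exact: cvg_cst.
    apply: (continuous_comp (f := fun v => tensor (T (r m)) (dfwith (block x m) j v))
      (g := fun u => braket u w : (R[i])^o)).
      exact: tensor_dfwith_continuous.
    exact: braket_continuous_l.
  - have dfw (r' : nat) (u : 'I_r' -> H) k a b : dfwith (dfwith u k a) k b = dfwith u k b.
      apply: funext => k'; have [<-|kk'] := eqVneq k k'; first by rewrite !dfwithin.
      by rewrite !dfwithout.
    rewrite (site_closure_tensor saA _ clchi) ?dfwithin//.
    rewrite (site_closure_tensor saA _ clw) ?dfwithin// !dfw.
    rewrite pp (bigD1 m)//= blockm; congr (_ * _).
    by apply: eq_bigr => m' mm'; rewrite blockm'.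
have := eq_dense (x i).
have -> : dfwith x i (x i) = x.
  apply: funext => k; have [<-|kk'] := eqVneq i k; first by rewrite !dfwithin.
  by rewrite !dfwithout.
have -> : dfwith (block x m) j (x i) = block x m.
  apply: funext => k; have [<-|kk'] := eqVneq j k; first by rewrite !dfwithin.
  by rewrite !dfwithout.
move=> ->; rewrite [RHS](bigD1 m)//= dfwithin; congr (_ * _).
by apply: eq_bigr => m' mm'; rewrite dfwithout// eq_sym.
Qed.

End ProductStates.

(** * Variances of linear combinations through covariances *)

Section Variance.
Context {R : realType} {K : hilbert R}.

(** Taking the real part symmetrizes: for symmetric operators it is the expectation of (AB + BA)/2
    whenever that is defined. *)
Definition op_covariance (A B : operator K) (psi : K) : R :=
  complex.Re (braket (A psi) (B psi)) - op_expectation A psi * op_expectation B psi.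

Lemma op_varianceE (A : operator K) psi :
  op_variance A psi = op_covariance A A psi.
Proof. by []. Qed.

Lemma Re_real_mul (x : R) (z : R[i]) : complex.Re (x%:C * z) = x * complex.Re z.
Proof. by case: z => a b /=; rewrite mul0r subr0. Qed.

Lemma op_variance_lincomb r (A : 'I_r -> operator K) (c : 'I_r -> R) psi :
  op_variance (op_lincomb c A) psi =
  \sum_i \sum_j c i * c j * op_covariance (A i) (A j) psi.
Proof.
rewrite /op_variance.
have -> : op_expectation (op_lincomb c A) psi = \sum_i c i * op_expectation (A i) psi.
  rewrite /op_expectation /= braket_sumr raddf_sum; apply: eq_bigr => i _.
  by rewrite braketZr -Re_real_mul.
rewrite /= braket_suml raddf_sum expr2 mulr_suml -sumrB; apply: eq_bigr => i _.
rewrite braket_sumr raddf_sum mulr_sumr -sumrB; apply: eq_bigr => j _.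
rewrite braketZl braketZr (_ : Num.conj _ = (c i)%:C); last exact: conjc_real.
rewrite /= !Re_real_mul /op_covariance; ring.
Qed.

(** The left side is the trace of the covariance matrix conjugated by [alpha]; orthonormality of the
    columns of [alpha] leaves only its diagonal. *)
Lemma sum_variance_orthogonal r (A : 'I_r -> operator K) (alpha : 'M[R]_r) psi :
  alpha *m alpha^T = 1%:M ->
  \sum_i op_variance (op_lincomb (alpha i) A) psi = \sum_i op_variance (A i) psi.
Proof.
move=> /mulmx1C aTa.
under eq_bigr do rewrite op_variance_lincomb.
rewrite exchange_big; apply: eq_bigr => j _ /=.
rewrite exchange_big (bigD1 j)//= [X in _ + X]big1 ?addr0 => [|k kj].
  rewrite -mulr_suml (_ : \sum_(i < r) _ = (alpha^T *m alpha) j j).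
    by rewrite aTa mxE eqxx mul1r.
  by rewrite mxE; apply: eq_bigr => i _; rewrite mxE.
rewrite -mulr_suml (_ : \sum_(i < r) _ = (alpha^T *m alpha) j k).
  by rewrite aTa mxE eq_sym (negbTE kj) mul0r.
by rewrite mxE; apply: eq_bigr => i _; rewrite mxE.
Qed.

End Variance.

(** * Collective variance of a single thick block *)

Definition block_bound {R : realType} (zeta : R) (x : nat) : R :=
  x%:R ^+ 2 / ((1 - zeta) + x%:R * zeta).

Section BlockVariance.
Context {R : realType} {H : hilbert R} {r : nat} (T : tensor_power H r).

Lemma collective_varianceE (A : operator H) (psi : T) :
  op_variance (collective_op T A) psi =
  \sum_i \sum_j op_covariance (site_op T A i) (site_op T A j) psi.
Proof.
rewrite op_variance_lincomb; apply: eq_bigr => i _; apply: eq_bigr => j _.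
by rewrite !mul1r.
Qed.

Lemma block_bound_denom_gt0 (zeta : R) (x : nat) : 0 <= zeta -> (0 < x)%N ->
  0 < (1 - zeta) + x%:R * zeta.
Proof.
by case: x => // x z0 _; rewrite mulrS; have := mulr_ge0 (ler0n R x) z0; lra.
Qed.

Lemma thick_collective_variance (A : operator H) (alpha : 'M[R]_r)
    (zeta d : R) (phi : T) :
  (0 < r)%N -> 0 <= zeta -> alpha *m alpha^T = 1%:M ->
  (forall i j : 'I_r, i = 0%N :> nat -> alpha i j = 1 / Num.sqrt r%:R) ->
  (forall i j : 'I_r, i = 0%N :> nat -> (0 < j)%N ->
     zeta * op_variance (mode_op T A alpha i) phi <=
     op_variance (mode_op T A alpha j) phi) ->
  (forall i, op_variance (site_op T A i) phi <= d) ->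
  op_variance (collective_op T A) phi <= block_bound zeta r * d.
Proof.
move=> r0 z0 aaT a1 thick vard; pose i0 : 'I_r := Ordinal r0.
have rr : 0 < r%:R :> R by rewrite ltr0n.
(* The first mode is the collective operator divided by the square root of [r]. *)
have mode0 : op_variance (collective_op T A) phi
    = r%:R * op_variance (mode_op T A alpha i0) phi.
  rewrite collective_varianceE op_variance_lincomb mulr_sumr.
  apply: eq_bigr => i _; rewrite mulr_sumr; apply: eq_bigr => j _.
  rewrite !a1// mulrA !div1r -invfM -expr2 sqr_sqrtr ?ler0n//.
  by rewrite mulfV ?mul1r// gt_eqF.
have : \sum_i op_variance (mode_op T A alpha i) phi <= r%:R * d.
  rewrite sum_variance_orthogonal// mulr_natl -[r in leRHS]card_ord -sumr_const.
  exact: ler_sum.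
rewrite (bigD1 i0)//= => sumd; set v := op_variance (mode_op _ _ _ i0) _ in mode0 sumd *.
(* Thickness is summed over the [r - 1] modes other than the first. *)
have : (r%:R - 1) * (zeta * v) <=
    \sum_(i | i != i0) op_variance (mode_op T A alpha i) phi.
  have -> : r%:R - 1 = r.-1%:R :> R.
    by rewrite -[in LHS](prednK r0) mulrS addrAC subrr add0r.
  rewrite mulr_natl.
  rewrite -[X in (_ *+ X.-1)]card_ord -(cardC1 i0) -sumr_const.
  apply: ler_sum => j j0; apply: thick => //; rewrite lt0n.
  by apply: contra j0 => /eqP h; apply/eqP/val_inj.
(* The two bounds combine to [v * ((1 - zeta) + r * zeta) <= r * d]. *)
move=> sumz; rewrite mode0 /block_bound mulrAC ler_pdivlMr ?block_bound_denom_gt0//.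
rewrite expr2 -!mulrA ler_pM2l//; nra.
Qed.

End BlockVariance.

(** * Additivity of the collective variance over blocks *)

Section ProductVariance.
Context {R : realType} {H : hilbert R} (T : forall r, tensor_power H r).
Context {n l : nat} {r : 'I_l -> nat} (e : {m : 'I_l & 'I_(r m)} -> 'I_n).
Context (A : operator H) (phi : forall m, T (r m)) (psi : T n).
Hypotheses (A_sa : self_adjoint A) (phi_pure : forall m, pure_state A (phi m))
  (psi_pure : pure_state A psi) (phi_psi : is_product_state e phi psi).

Local Notation site m j := (e (Tagged (fun m => 'I_(r m)) (i:=m) j)).
Local Notation Hphi m j := (site_op (T (r m)) A j (phi m)).

Lemma site_op_product_state m (j : 'I_(r m)) :
  is_product_state e (dfwith phi m (Hphi m j)) (site_op (T n) A (site m j) psi).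
Proof.
by apply: (site_product_state A_sa phi_psi); apply: site_op_closure;
  [exact: (phi_pure m).2 | exact: psi_pure.2].
Qed.

Lemma braket_phi m : braket (phi m) (phi m) = 1.
Proof. by rewrite braket_norm (phi_pure m).1 expr1n. Qed.

Lemma site_expectation m (j : 'I_(r m)) :
  op_expectation (site_op (T n) A (site m j)) psi =
  op_expectation (site_op (T (r m)) A j) (phi m).
Proof.
rewrite /op_expectation.
rewrite (braket_product_states (site_op_product_state j) phi_psi).
rewrite (bigD1 m)//= dfwithin big1 ?mulr1// => m' mm'.
by rewrite dfwithout 1?eq_sym// braket_phi.
Qed.

Lemma site_covariance_block m (j j' : 'I_(r m)) :
  op_covariance (site_op (T n) A (site m j)) (site_op (T n) A (site m j')) psi =
  op_covariance (site_op (T (r m)) A j) (site_op (T (r m)) A j') (phi m).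
Proof.
rewrite /op_covariance !site_expectation.
rewrite (braket_product_states (site_op_product_state j') (site_op_product_state j)).
rewrite (bigD1 m)//= !dfwithin big1 ?mulr1// => m' mm'.
by rewrite !dfwithout 1?eq_sym// braket_phi.
Qed.

(** The bracket factors into one expectation per block. Both are real, so the real part of their
    product is the product of their real parts. *)
Lemma site_covariance_blocks m m' (j : 'I_(r m)) (j' : 'I_(r m')) : m != m' ->
  op_covariance (site_op (T n) A (site m j)) (site_op (T n) A (site m' j')) psi = 0.
Proof.
move=> mm'; rewrite /op_covariance !site_expectation.
rewrite (braket_product_states (site_op_product_state j') (site_op_product_state j)).
rewrite (bigD1 m)//= (bigD1 m')/=; last by rewrite eq_sym.
rewrite !dfwithin big1 ?mulr1 => [|k /andP[km km']].
  rewrite dfwithout 1?eq_sym// dfwithout// /op_expectation.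
  have im1 := site_expectation_real A_sa ((phi_pure m).2 j).
  have im2 := site_expectation_real A_sa ((phi_pure m').2 j').
  rewrite braketC; case: (braket (phi m) _) im1 => a b /= ->.
  by case: (braket (phi m') _) im2 => a' b' /= ->; ring.
by rewrite !dfwithout 1?eq_sym// braket_phi.
Qed.

Lemma collective_variance_product :
  op_variance (collective_op (T n) A) psi =
  \sum_m op_variance (collective_op (T (r m)) A) (phi m).
Proof.
rewrite collective_varianceE (big_sites _ _ phi_psi.1); apply: eq_bigr => m _.
rewrite collective_varianceE; apply: eq_bigr => j _.
rewrite (big_sites _ _ phi_psi.1) (bigD1 m)//= [X in _ + X]big1 ?addr0.
  by apply: eq_bigr => j' _; exact: site_covariance_block.
move=> m' mm'; apply: big1 => j' _.
by apply: site_covariance_blocks; rewrite eq_sym.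
Qed.

End ProductVariance.

(** * Optimization over the block sizes *)

Section BlockBound.
Context {R : realType} (zeta : R).
Hypothesis zeta_ge0 : 0 <= zeta.
Local Notation f := (block_bound zeta).

Lemma block_bound0 : f 0 = 0.
Proof. by rewrite /block_bound expr0n mul0r. Qed.

Lemma block_bound_ge0 x : 0 <= f x.
Proof.
case: x => [|x]; first by rewrite block_bound0.
by rewrite divr_ge0 ?exprn_ge0// ltW// block_bound_denom_gt0.
Qed.

(* The slope of [f] between [x] and [y] is [num / den] with
   [den = p ^+ 2 + zeta * num], hence monotone in [num]. *)
Lemma block_bound_convex a b c d : zeta <= 1 ->
  (d <= a)%N -> (d <= b)%N -> (b <= c)%N -> (a + b = c + d)%N ->
  f a + f b <= f c + f d.
Proof.
move=> z1 da db bc abcd.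
(* For [zeta = 1] the denominator vanishes at 0 and the slope formula breaks down, but [f] is then
   the identity. *)
have [z1E|zn1] := eqVneq zeta 1.
  have fE x : f x = x%:R.
    case: x => [|x]; first by rewrite block_bound0.
    by rewrite /block_bound z1E subrr add0r mulr1 expr2 mulfK// pnatr_eq0.
  by rewrite !fE -!natrD abcd.
pose p : R := 1 - zeta; have p0 : 0 < p by rewrite subr_gt0 lt_neqAle zn1.
pose num (x y : R) := (x + y) * p + zeta * x * y.
have den0 (x : nat) : 0 < p + x%:R * zeta by rewrite ltr_pwDl// mulr_ge0.
have slope (x y : nat) : f y - f x =
    (y%:R - x%:R) * (num x%:R y%:R / (p ^+ 2 + zeta * num x%:R y%:R)).
  rewrite (_ : p ^+ 2 + _ = (p + x%:R * zeta) * (p + y%:R * zeta)); last by rewrite /num; ring.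
  by rewrite /block_bound /num -/p; field; rewrite !gt_eqF.
have num0 (x y : nat) : 0 <= num x%:R y%:R.
  by apply: addr_ge0; apply: mulr_ge0; rewrite ?(ltW p0)//; [exact: addr_ge0|exact: mulr_ge0].
(* The intervals from [a] to [c] and from [d] to [b] have equal length, so only the slopes have to
   be compared. *)
rewrite -subr_ge0 (_ : _ - _ = (f c - f a) - (f b - f d)); last by ring.
have cabd : c%:R - a%:R = b%:R - d%:R :> R.
  by apply/eqP; rewrite subr_eq addrAC eq_sym subr_eq -!natrD addnC abcd.
rewrite !slope cabd -mulrBr mulr_ge0 ?subr_ge0 ?ler_nat//.
have p2 : 0 < p ^+ 2 by rewrite exprn_gt0.
have dn x y : 0 < p ^+ 2 + zeta * num (x%:R : R) (y%:R : R).
  by rewrite ltr_pwDl// mulr_ge0.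
rewrite ler_pdivrMr// mulrAC ler_pdivlMr//.
have numle : num d%:R b%:R <= num a%:R c%:R.
  apply: lerD; first by apply: ler_wpM2r; [exact: ltW | rewrite lerD ?ler_nat].
  by rewrite -!mulrA; apply: ler_wpM2l => //; apply: ler_pM; rewrite ?ler_nat.
have := ler_wpM2r (ltW p2) numle; lra.
Qed.

(** Divisibility needs no case distinction, because [f 0 = 0] removes the remainder term. *)
Definition partition_bound (k n : nat) : R := (n %/ k)%:R * f k + f (n %% k).

(** Only the remainder [s] interacts with the new block. If [a = k], a full block is added; if
    [s + a < k], the two merge; otherwise they are replaced by a full block and a remainder
    [s + a - k]. Convexity shows that the last two moves do not decrease the sum. *)
Lemma partition_bound_add k n a :
  (0 < k)%N -> ((1 < k)%N -> zeta <= 1) -> (a <= k)%N ->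
  partition_bound k n + f a <= partition_bound k (n + a).
Proof.
move=> k0 z1 ak; rewrite /partition_bound.
rewrite [in leRHS](divn_eq n k) -!addnA divnMDl// modnMDl.
have sk := ltn_pmod n k0; set s := (n %% k)%N in sk *.
(* Convexity is applied only when [0 < a < k], which forces [1 < k] and hence gives [zeta <= 1]. *)
have z1' : (0 < a)%N -> (a < k)%N -> zeta <= 1.
  by move=> a0 ak'; apply: z1; apply: leq_ltn_trans ak'.
case: a ak z1' => [|a] ak z1'.
  by rewrite block_bound0 addr0 addn0 (divn_small sk) addn0 modn_small.
move: (a.+1) (ltn0Sn a) ak z1' => {}a a0 ak z1'.
move: ak; rewrite leq_eqVlt => /orP[/eqP ->|ak].
  rewrite divnDr// divnn k0 (divn_small sk) modnDr (modn_small sk) add0n natrD /=; lra.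
have {z1'}z1' := z1' a0 ak.
have [sak|ksa] := ltnP (s + a) k.
  rewrite (divn_small sak) addn0 (modn_small sak) -addrA lerD2l.
  have := @block_bound_convex s a (s + a) 0 z1'; rewrite block_bound0 addr0; apply; lia.
have -> : (s + a = k + (s + a - k))%N by lia.
have skk : (s + a - k < k)%N by lia.
rewrite divnDl// divnn k0 (divn_small skk) modnDl (modn_small skk).
rewrite addn0 natrD mulrDl mul1r -!addrA lerD2l.
by apply: block_bound_convex => //; lia.
Qed.

Lemma sum_block_bound k l (r : 'I_l -> nat) :
  (0 < k)%N -> ((1 < k)%N -> zeta <= 1) -> (forall m, (r m <= k)%N) ->
  \sum_m f (r m) <= partition_bound k (\sum_m r m).
Proof.
move=> k0 z1 rk; elim/big_rec2: _ => [|m x y _ xy].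
  by rewrite /partition_bound div0n mod0n mul0r block_bound0 addr0.
by rewrite addnC addrC; apply: le_trans (partition_bound_add _ k0 z1 (rk m)); rewrite lerD2r.
Qed.

(** Full blocks attain the bound exactly. For the remainder [s < k], it holds because
    [x / ((1 - zeta) + x * zeta)] is nondecreasing when [zeta <= 1]. *)
Lemma partition_bound_le k n : (0 < k)%N -> ((1 < k)%N -> zeta <= 1) ->
  partition_bound k n <= (k * n)%:R / ((1 - zeta) + k%:R * zeta).
Proof.
move=> k0 z1; rewrite /partition_bound.
have Dk := block_bound_denom_gt0 zeta_ge0 k0.
rewrite [in leRHS](divn_eq n k) mulnDr natrD mulrDl lerD//.
  by rewrite /block_bound mulrA !natrM; lra.
have sk := ltn_pmod n k0; set s := (n %% k)%N in sk *.
have [->|s0] := posnP s; first by rewrite block_bound0 muln0 mul0r.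
have {}z1 : zeta <= 1 by apply: z1; apply: leq_ltn_trans sk.
have Ds := block_bound_denom_gt0 zeta_ge0 s0.
rewrite /block_bound ler_pdivrMr// mulrAC ler_pdivlMr// natrM expr2.
(* This is the comparison left after cross-multiplying and cancelling the terms in
   [s * k * zeta]. *)
have : s%:R * (1 - zeta) <= k%:R * (1 - zeta).
  by rewrite ler_wpM2r ?subr_ge0// ler_nat ltnW.
move=> /(ler_wpM2l (ler0n R s)); lra.
Qed.

End BlockBound.

(* The bound on the coherence ratio *)
Local Close Scope complex_scope.
Unset Implicit Arguments.

Theorem mainTheorem12 (R : realType) (H : hilbert R) (Ham : operator H)
    (hHam : self_adjoint Ham) (hnondeg : nondegenerate_eigenvalues Ham)
    (T : forall r : nat, tensor_power H r)
    (alpha : forall r : nat, 'M[R]_r)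
    (halpha : forall r : nat, alpha r *m (alpha r)^T = 1%:M)
    (halpha1 : forall (r : nat) (i j : 'I_r), i = 0%N :> nat ->
       alpha r i j = 1 / Num.sqrt r%:R)
    (n k : nat) (hk : (1 <= k)%N) (hkn : (k <= n)%N)
    (zeta : R) (hzeta : 0 <= zeta) (hzeta1 : (1 < k)%N -> zeta <= 1)
    (psi : T n) (hpsi : pure_state Ham psi)
    (l : nat) (r : 'I_l -> nat) (hr : forall m : 'I_l, (1 <= r m <= k)%N)
    (e : {m : 'I_l & 'I_(r m)} -> 'I_n)
    (phi : forall m : 'I_l, T (r m)) (hphi : forall m, pure_state Ham (phi m))
    (hprod : is_product_state e phi psi)
    (hthick : forall (m : 'I_l) (i j : 'I_(r m)), i = 0%N :> nat -> (0 < j)%N ->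
       op_variance (mode_op (T (r m)) Ham (alpha (r m)) j) (phi m)
       >= zeta * op_variance (mode_op (T (r m)) Ham (alpha (r m)) i) (phi m)) :
  let q := (n %/ k)%N in
  let s := (n - q * k)%N in
  let B := q%:R * (k%:R ^+ 2 / ((1 - zeta) + k%:R * zeta))
         + (if (k %| n)%N then 0
            else s%:R ^+ 2 / ((1 - zeta) + s%:R * zeta)) in
  coherence_ratio Ham psi <= B /\
  B <= (k * n)%:R / ((1 - zeta) + k%:R * zeta).
Proof.
move=> q s B.
have BE : B = partition_bound zeta k n.
  have sE : (n %% k)%N = s by have := divn_eq n k; lia.
  rewrite /B /partition_bound sE.
  congr (_ + _).
  case: ifP => // /dvdnP[t nE].
  have -> : s = 0%N by rewrite /s /q nE mulnK// subnn.
  by rewrite block_bound0.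
rewrite BE; split; last exact: partition_bound_le.
have bound0 : 0 <= partition_bound zeta k n.
  have f0 := block_bound_ge0 hzeta.
  by apply: addr_ge0 => //; apply: mulr_ge0.
rewrite /coherence_ratio; set d := \big[_/_]_(i < n) _.
(* If [d = 0] the ratio is 0 by convention, and [bound0] suffices. *)
have [//|d0] := eqVneq d 0.
have d_gt0 : 0 < d by rewrite lt_def d0; exact: bigmax_ge_id.
(* A site of a block has the same variance in [phi m] as the corresponding site has in [psi]. *)
have vard m (j : 'I_(r m)) : op_variance (site_op (T (r m)) Ham j) (phi m) <= d.
  rewrite op_varianceE -(site_covariance_block hHam hphi hpsi hprod) -op_varianceE.
  exact: le_bigmax.
rewrite ler_pdivrMr// (collective_variance_product hHam hphi hpsi hprod).
(* The sites are counted through the bijection [e]. *)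
have r_sum : (\sum_m r m = n)%N.
  have := big_sites addn (fun=> 1%N) hprod.1.
  rewrite sum1_card card_ord => ->; apply: eq_bigr => m _.
  by rewrite sum1_card card_ord.
apply: (@le_trans _ _ (\sum_m block_bound zeta (r m) * d)).
  apply: ler_sum => m _; have /andP[r0 _] := hr m.
  exact: (thick_collective_variance r0 hzeta (halpha _) (halpha1 (r m)) (@hthick m) (vard m)).
rewrite -mulr_suml; apply: ler_wpM2r; first exact: ltW.
rewrite -[in leRHS]r_sum.
by apply: sum_block_bound => // m; have /andP[] := hr m.
Qed.
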